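(* Let $\Delta_A,\Delta_B$ be positive integers satisfying at least one of the following: (i) $\Delta_A\ge 165$ and $\Delta_A\ge\Delta_B\ge 56$; (ii) $\Delta_A\le 55$ and $\Delta_B\ge 153$; (iii) $\Delta_B\ge 165$ and $\Delta_B\ge\Delta_A\ge 56$; (iv) $\Delta_B\le 55$ and $\Delta_A\ge 153$. Then every finite bipartite graph $G=(A\cup B,E)$ with parts $A$ and $B$, in which every vertex of $A$ has degree at most $\Delta_A$ and every vertex of $B$ has degree at most $\Delta_B$, is $(\lceil\Delta_A/2\rceil+1,\lceil\Delta_B/2\rceil+1)$-choosable.
   Context: For a bipartite graph $G$ with parts $A,B$ and positive integers $k_A,k_B$, a $(k_A,k_B)$-list-assignment is a map $L$ assigning to each vertex of $A$ a set of exactly $k_A$ positive integers and to each vertex of $B$ a set of exactly $k_B$ positive integers. $G$ is $(k_A,k_B)$-choosable if for every $(k_A,k_B)$-list-assignment $L$ there is a proper colouring $c$ of $G$ with $c(v)\in L(v)$ for every vertex $v$ (proper meaning adjacent vertices receive distinct colours). *)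

(* Defs.v *)
From mathcomp Require Import all_boot finmap.

Set Implicit Arguments.
Unset Strict Implicit.
Unset Printing Implicit Defensive.

Section BipartiteChoosability.

Variables (V : finType) (e : rel V).

Definition simple_graph : Prop := symmetric e /\ irreflexive e.

(* The parts may be empty. *)
Definition bipartite_with_parts (A B : {set V}) : Prop :=
  [/\ A :|: B = [set: V],
      [disjoint A & B]
    & forall u v : V, e u v ->
        (u \in A /\ v \in B) \/ (u \in B /\ v \in A)].

Definition degree (v : V) : nat := #|[set w | e v w]|.

Definition list_assignment (A B : {set V}) (kA kB : nat)
    (L : V -> {fset nat}) : Prop :=
  [/\ forall v x, x \in L v -> 0 < x,
      forall v, v \in A -> #|` L v| = kA
    & forall v, v \in B -> #|` L v| = kB].

Definition proper_colouring (c : V -> nat) : Prop :=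
  forall u v : V, e u v -> c u <> c v.

Definition choosable (A B : {set V}) (kA kB : nat) : Prop :=
  forall L : V -> {fset nat}, list_assignment A B kA kB L ->
    exists2 c : V -> nat, proper_colouring c & forall v, c v \in L v.

End BipartiteChoosability.

(* Main.v *)
Require Import Defs.
From mathcomp Require Import all_boot all_order all_algebra finmap zify ring lra.

(** Colour every vertex of B independently and uniformly from its list; it
    suffices that no v in A sees its whole list among its neighbours.  With
    q = 1 - 1/kB, and d_x the number of neighbours of v whose list contains the
    colour x, the probability that v sees its whole list is at most the product
    of the 1 - q^(d_x) over x in L(v).  As the d_x sum to at most DA kB, AM-GM
    bounds it by (1 - q^(2 kB))^kA <= 0.87^kA when kB >= 29; when DA is small
    compared with kB, the trivial d_x <= DA gives (DA/kB)^kA instead.  Call p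
    the resulting bound.  The events "v sees its whole list" are avoided
    simultaneously by a counting argument that replaces the Lovasz local lemma:
    if DB p <= d (1 - d)^(DA - 1), then revealing the colour of one more vertex
    of B keeps at least a proportion 1 - d of the good colourings.  Take
    d = 1/(2 DA) when both degrees are at least 56 and d = 1/(DA + 1) when
    DA <= 55; the other two cases follow by exchanging A and B. *)

Set Implicit Arguments.
Unset Strict Implicit.
Unset Printing Implicit Defensive.

Import Order.TTheory GRing.Theory Num.Theory.

Local Open Scope ring_scope.

(** * Elementary inequalities and numerical estimates *)

Lemma bernoulli_ineq (R : realFieldType) (x : R) (n : nat) :
  -1 <= x -> 1 + n%:R * x <= (1 + x) ^+ n.
Proof.
move=> x1; elim: n => [|n IHn]; first by rewrite mul0r addr0 expr0.
have x1' : 0 <= 1 + x by lra.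
rewrite exprS; apply: le_trans (ler_wpM2l x1' IHn).
rewrite -subr_ge0 (_ : _ - _ = n%:R * (x * x)); last by rewrite -natr1; ring.
by rewrite mulr_ge0 ?ler0n // -expr2 sqr_ge0.
Qed.

Lemma sub_inv_itv (R : realFieldType) (k : nat) : (0 < k)%N ->
  0 <= 1 - (k%:R^-1 : R) <= 1.
Proof.
by move=> k0; rewrite subr_ge0 lerBlDr lerDl invr_ge0 ler0n invf_le1 ?ltr0n // ler1n k0.
Qed.

(** The two bases have ratio 1 + t with t = 1/(k^2 - 1), and by Bernoulli (1 + t)^k makes up for the
    one extra factor k/(k + 1). *)
Lemma sub_inv_exp_incr (R : realFieldType) (k : nat) : (1 < k)%N ->
  (1 - k%:R^-1) ^+ k <= (1 - k.+1%:R^-1) ^+ k.+1 :> R.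
Proof.
move=> k1; have k1R : 1 < k%:R :> R by rewrite ltr1n.
rewrite -natr1; set x : R := k%:R in k1R *.
have q0 : 0 < 1 - x^-1 by rewrite subr_gt0 invf_lt1 //; lra.
pose t := (x ^+ 2 - 1)^-1.
have x2 : 0 < x ^+ 2 - 1 by rewrite subr_gt0 exprn_egt1 //.
have t0 : 0 < t by rewrite invr_gt0.
have Dq : 1 - (x + 1)^-1 = (1 - x^-1) * (1 + t).
  by rewrite /t; field; rewrite !gt_eqF //; lra.
rewrite exprSr {1}Dq exprMn -mulrA ler_peMr ?exprn_ge0 ?(ltW q0) //.
have [q'0 t1] : 0 <= 1 - (x + 1)^-1 /\ -1 <= t.
  by split; [rewrite subr_ge0 invf_le1; lra | lra].
apply: le_trans (ler_wpM2r q'0 (bernoulli_ineq k t1)).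
rewrite -/x -subr_ge0 /t (_ : _ - _ = (x ^+ 2 - 1)^-1 / (x + 1)); last first.
  by field; rewrite !gt_eqF //; lra.
by rewrite divr_ge0 ?ltW //; lra.
Qed.

(** By monotonicity the case k = 29 suffices, and that is a computation. The bound 29 is the list
    size [uphalf 56 + 1]. *)
Lemma sub_inv_exp2_ge (R : realFieldType) (k : nat) : (29 <= k)%N ->
  13 / 100 <= (1 - k%:R^-1) ^+ (2 * k) :> R.
Proof.
move=> k29; rewrite mulnC exprM.
have base : 13 / 100 <= ((1 - 29%:R^-1) ^+ 29) ^+ 2 :> R by rewrite -exprM; lra.
suff le29 : (1 - 29%:R^-1) ^+ 29 <= (1 - k%:R^-1) ^+ k :> R.
  apply: le_trans base _; apply: lerXn2r le29; rewrite nnegrE exprn_ge0 // subr_ge0.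
    by lra.
  by rewrite invf_le1 ?ler1n ?ltr0n; lia.
elim: k k29 => // k IHk; rewrite leq_eqVlt => /predU1P[<- //|k29].
by apply: le_trans (IHk k29) (sub_inv_exp_incr _ _); lia.
Qed.

(** Passing from k to k + 1 multiplies the left side by 0.87 (1 + 1/k)^2, which is below 1 in this
    range. The value 83 is [uphalf 165], and k + 1 stands for [kA]. *)
Lemma sq_mul_exp_le1 (R : realFieldType) (k : nat) : (83 <= k)%N ->
  16 * k%:R ^+ 2 * (87 / 100) ^+ k.+1 <= 1 :> R.
Proof.
elim: k => // k IHk; rewrite leq_eqVlt => /predU1P[<-|k83]; first by lra.
have {IHk} := IHk k83; apply: le_trans.
have k83R : 83 <= k%:R :> R by rewrite (ler_nat _ 83).
rewrite [_ ^+ k.+2]exprS mulrA ler_wpM2r ?exprn_ge0 //; first by lra.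
by rewrite -natr1; nra.
Qed.

(** Cleared of denominators, this is the condition DB p <= d (1 - d)^(n - 1) with d = 1/(n + 1), DA
    = n, kB = 78 and DB replaced by 2 kB. The 55 cases are checked one by one. *)
Lemma unbalanced_exp_bound (n : nat) : (0 < n <= 55)%N ->
  (n.+1 ^ n * (2 * 78) * n ^ (uphalf n).+1 <= n ^ n.-1 * 78 ^ (uphalf n).+1)%N.
Proof.
pose ok m :=
  (m.+1 ^ m * (2 * 78) * m ^ (uphalf m).+1 <= m ^ m.-1 * 78 ^ (uphalf m).+1)%N.
suff /allP ok55 : all ok (iota 1 55).
  by move=> n55; apply: ok55; rewrite mem_iota; lia.
rewrite /iota /all /ok.
by repeat (apply/andP; split; first by rewrite /uphalf /predn; lia).
Qed.

(** * Uniform probability on the functions from V to K *)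

Section UniformProbability.
Variables (R : realFieldType) (V K : finType).
Implicit Types (P Q : pred {ffun V -> K}) (S T : {set V}).

Definition pr P : R := #|[set f | P f]|%:R / #|{ffun V -> K}|%:R.

Definition depends_on T P :=
  forall f g : {ffun V -> K}, {in T, f =1 g} -> P f = P g.

Lemma pr_ge0 P : 0 <= pr P.
Proof. by rewrite divr_ge0 ?ler0n. Qed.

Lemma pr_mono P Q : (forall f, P f -> Q f) -> pr P <= pr Q.
Proof.
move=> sPQ; rewrite ler_wpM2r ?invr_ge0 ?ler0n // ler_nat subset_leq_card //.
by apply/subsetP => f; rewrite !inE; apply: sPQ.
Qed.

Lemma eq_pr P Q : P =1 Q -> pr P = pr Q.
Proof.
by move=> eqPQ; apply/le_anti/andP; split; apply: pr_mono => f; rewrite eqPQ.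
Qed.

Lemma pr_orb P Q : pr (fun f => P f || Q f) <= pr P + pr Q.
Proof.
rewrite -mulrDl ler_wpM2r ?invr_ge0 ?ler0n // -natrD ler_nat.
apply: leq_trans (leq_card_setU _ _); apply: subset_leq_card.
by apply/subsetP => f; rewrite !inE.
Qed.

Lemma pr_false P : (forall f, ~~ P f) -> pr P = 0.
Proof.
move=> noP; rewrite /pr (_ : [set f | P f] = set0) ?cards0 ?mul0r //.
by apply/setP=> f; rewrite !inE (negPf (noP f)).
Qed.

Lemma pr_exists (I : finType) (J : pred I) (P : I -> pred {ffun V -> K}) :
  pr (fun f => [exists i, J i && P i f]) <= \sum_(i | J i) pr (P i).
Proof.
have step (s : seq I) :
    pr (fun f => has (fun i => J i && P i f) s) <= \sum_(i <- s | J i) pr (P i).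
  elim: s => [|i s IHs]; first by rewrite big_nil pr_false.
  rewrite big_cons /=; case: (J i) => //=.
  by apply: le_trans (pr_orb _ _) _; rewrite lerD2l.
apply: le_trans (step (index_enum I)); apply: pr_mono => f.
by case/existsP=> i Pi; apply/hasP; exists i; rewrite ?mem_index_enum.
Qed.

Hypothesis K_gt0 : (0 < #|K|)%N.

Lemma card_space_neq0 : #|{ffun V -> K}|%:R != 0 :> R.
Proof. by rewrite pnatr_eq0 card_ffun -lt0n expn_gt0 K_gt0. Qed.

Lemma pr_true P : (forall f, P f) -> pr P = 1.
Proof.
move=> allP; rewrite /pr (_ : [set f | P f] = setT) ?cardsT ?divff ?card_space_neq0 //.
by apply/setP=> f; rewrite !inE allP.
Qed.

Lemma pr_gt0_ex P : 0 < pr P -> exists f, P f.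
Proof.
move=> P_gt0; case: (pickP P) => [f Pf|noP]; first by exists f.
by move: P_gt0; rewrite pr_false ?ltxx // => f; rewrite noP.
Qed.

Lemma pr_cover P (I : finType) (Q : I -> pred {ffun V -> K}) :
    (forall f, P f -> exists i, Q i f) ->
  pr P <= \sum_i pr (Q i).
Proof.
move=> covP; apply: le_trans (pr_exists predT Q); apply: pr_mono => f /covP[i Qi].
by apply/existsP; exists i.
Qed.

(* Exchanging the coordinates outside T is an involution of pairs (f, g)
   which carries the pairs with P f and Q g to those with P f and Q f. *)
Lemma pr_indep T P Q : depends_on T P -> depends_on (~: T) Q ->
  pr (fun f => P f && Q f) = pr P * pr Q.
Proof.
move=> depP depQ.
pose mix (f g : {ffun V -> K}) : {ffun V -> K} :=
  [ffun v => if v \in T then f v else g v].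
pose swap (fg : {ffun V -> K} * {ffun V -> K}) := (mix fg.1 fg.2, mix fg.2 fg.1).
have swapK : involutive swap.
  by case=> f g; rewrite /swap /=; congr (_, _); apply/ffunP=> v; rewrite !ffunE;
     case: (v \in T).
have mixP f g : P (mix f g) = P f.
  by apply: depP => v vT; rewrite ffunE vT.
have mixQ f g : Q (mix f g) = Q g.
  by apply: depQ => v; rewrite ffunE inE => /negPf->.
have cardPQ : (#|[set f | P f && Q f]| * #|{ffun V -> K}|
               = #|[set f | P f]| * #|[set f | Q f]|)%N.
  rewrite -(cardsT {ffun V -> K}) -!cardsX -[LHS](card_imset _ (inv_inj swapK)).
  congr #|pred_of_set _|; apply/setP=> fg; apply/imsetP/idP => [[[f g] + ->]|].
    by rewrite !inE /= andbT mixP mixQ.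
  rewrite !inE => PQ; exists (swap fg); last by rewrite swapK.
  by rewrite !inE /= andbT mixP mixQ.
have nz := card_space_neq0.
rewrite /pr mulf_div -natrM -cardPQ natrM -mulf_div divff // mulr1.
by [].
Qed.

Lemma pr_coord (u : V) (j : K) : pr (fun f => f u == j) = #|K|%:R^-1.
Proof.
pose F v : pred K := if v == u then pred1 j else predT.
have -> : pr (fun f => f u == j) = #|family F|%:R / #|{ffun V -> K}|%:R.
  congr (_%:R / _); apply: eq_card => f; rewrite inE.
  apply/eqP/familyP => [fu v|/(_ u)]; last by rewrite /F eqxx => /eqP.
  by rewrite /F; case: eqP => // ->; rewrite fu inE.
have K0 : #|K|%:R != 0 :> R by rewrite pnatr_eq0 -lt0n.
rewrite card_family foldrE big_image /= (bigD1 u) //= /F eqxx card1 mul1n.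
rewrite (eq_bigr (fun=> #|K|)); last by move=> v /negPf ->.
rewrite card_ffun prod_nat_const.
have -> : #|V| = (#|[pred i | i != u]|).+1.
  by rewrite (cardD1 u) inE; congr _.+1; apply: eq_card => v; rewrite !inE andbT.
by rewrite expnS natrM invfM mulrCA divff ?mulr1 // natrX expf_neq0.
Qed.

End UniformProbability.

(** * A local lemma proved by counting *)

Section LocalLemma.
Variables (R : realFieldType) (V K I : finType).
Variables (nb : I -> {set V}) (bad : I -> {set V} -> pred {ffun V -> K}).
Variables (DA DB : nat) (p d : R).
Hypotheses (K_gt0 : (0 < #|K|)%N)
  (bad_dep : forall i T, depends_on T (bad i T))
  (bad_mono : forall i (S T : {set V}) f, S \subset T -> bad i S f -> bad i T f)
  (bad0 : forall i f, ~~ bad i set0 f)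
  (bad_pr : forall i (T : {set V}), T \subset nb i -> pr R (bad i T) <= p)
  (card_nb : forall i, (#|nb i| <= DA)%N)
  (card_nbC : forall u, (#|[set i | u \in nb i]| <= DB)%N)
  (p_ge0 : 0 <= p) (d_ge0 : 0 <= d) (d_lt1 : d < 1)
  (pd : DB%:R * p <= d * (1 - d) ^+ DA.-1).

(** Here S is the set of coordinates revealed so far; by [bad_mono], the event shrinks as S
    grows. *)
Let good (S : {set V}) (f : {ffun V -> K}) := [forall i, ~~ bad i (S :&: nb i) f].

Let good_dep (S T : {set V}) : S \subset T -> depends_on T (good S).
Proof.
move=> sST f g eq_fg; apply: eq_forallb => i; congr (~~ _).
by apply: bad_dep => v /setIP[vS _]; apply/eq_fg/(subsetP sST).
Qed.

(** The elements of S outside S' are added one at a time, each at the cost of a factor 1 - d. The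
    bound n lets [pr_good_step] apply this to its own induction hypothesis. *)
Let pr_good_chain n :
    (forall (S : {set V}) u, (#|S| < n)%N -> u \notin S ->
       (1 - d) * pr R (good S) <= pr R (good (u |: S))) ->
  forall S S' : {set V}, (#|S| <= n)%N -> S' \subset S ->
    (1 - d) ^+ #|S :\: S'| * pr R (good S') <= pr R (good S).
Proof.
move=> IH S S' leSn sS'S; move Dm: #|S :\: S'| => m.
elim: m S leSn sS'S Dm => [|m IHm] S leSn sS'S Dm.
  move/eqP: Dm; rewrite cards_eq0 setD_eq0 => sSS'.
  by rewrite expr0 mul1r (_ : S = S') //; apply/eqP; rewrite eqEsubset sSS'.
have [u uSS'] : exists u, u \in S :\: S' by apply/card_gt0P; rewrite Dm.
have /setDP[uS uS'] := uSS'.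
have cardS : #|S| = #|S :\ u|.+1 by rewrite (cardsD1 u) uS.
have leSun : (#|S :\ u| < n)%N by rewrite -cardS.
have := IH (S :\ u) u leSun; rewrite !inE eqxx setD1K // => /(_ isT).
apply: le_trans; rewrite exprS -mulrA ler_wpM2l ?subr_ge0 ?(ltW d_lt1) //.
apply: IHm; first exact: ltnW.
  by rewrite subsetD1 sS'S.
have : S :\: S' :\ u = S :\ u :\: S'.
  by apply/setP=> x; rewrite !inE andbCA.
by move=> <-; apply: succn_inj; rewrite -Dm [RHS](cardsD1 u) uSS'.
Qed.

(** If revealing u destroys goodness, then some i with u in [nb i] turns bad. The loss due to each
    such i is compared with [good S] through the chain, available by strong induction on the size of
    S. *)
Let pr_good_step (S : {set V}) (u : V) :
  u \notin S -> (1 - d) * pr R (good S) <= pr R (good (u |: S)).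
Proof.
move Dn: #|S| => n; elim/ltn_ind: n => n IHn in S u Dn * => uS.
have IH (S' : {set V}) (v : V) : (#|S'| < n)%N -> v \notin S' ->
    (1 - d) * pr R (good S') <= pr R (good (v |: S')).
  by move=> ltS'n; apply: IHn ltS'n _ _ _.
have c_gt0 : 0 < (1 - d) ^+ DA.-1 by rewrite exprn_gt0 // subr_gt0.
have goodW (S1 S2 : {set V}) f : S1 \subset S2 -> good S2 f -> good S1 f.
  move=> sS12 /forallP good2; apply/forallP=> i; apply: contra (good2 i).
  exact/bad_mono/setSI.
(* Goodness is retained only off [nb i], so that the two events depend on disjoint sets of
   coordinates and are independent. *)
pose lost i f := good (S :\: nb i) f && bad i ((u |: S) :&: nb i) f.
have lost_le i : u \in nb i -> (1 - d) ^+ DA.-1 * pr R (lost i) <= p * pr R (good S).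
  move=> ui; rewrite (@eq_pr R _ _ _ (fun f => bad i ((u |: S) :&: nb i) f
                                          && good (S :\: nb i) f)); last first.
    by move=> f; rewrite andbC.
  rewrite (pr_indep _ K_gt0 (T := nb i)); first last.
  - by apply: good_dep; apply/subsetP=> v; rewrite !inE => /andP[].
  - move=> f g eq_fg; apply: bad_dep => v /setIP[_]; exact: eq_fg.
  rewrite mulrCA; apply: ler_pM; first exact: pr_ge0.
    by rewrite mulr_ge0 ?pr_ge0 ?(ltW c_gt0).
    by apply: bad_pr; apply: subsetIr.
  apply: le_trans (pr_good_chain IH _ (subsetDl S (nb i))); last by rewrite Dn.
  rewrite ler_wpM2r ?pr_ge0 //; apply: ler_wiXn2l; rewrite ?subr_ge0 ?(ltW d_lt1) //.
    by rewrite lerBlDr lerDl.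
  have -> : S :\: (S :\: nb i) = S :&: nb i.
    by apply/setP=> v; rewrite !inE; case: (v \in S); case: (v \in nb i).
  (* As u lies in [nb i] but not in S, the chain has at most DA - 1 links. *)
  have : (#|S :&: nb i| < #|nb i|)%N.
    apply/proper_card/properP; split; first exact: subsetIr.
    by exists u; rewrite // inE negb_and uS.
  by move=> lt; have := leq_trans lt (card_nb i); case: (DA).
have cover :
    pr R (good S) <= pr R (good (u |: S)) + \sum_(i | u \in nb i) pr R (lost i).
  apply: le_trans (lerD (lexx _) (pr_exists _ _ _)).
  apply: le_trans (pr_orb _ _ _); apply: pr_mono => f gS.
  case gSu: (good (u |: S) f) => //=.
  move/negbT: gSu; rewrite negb_forall => /existsP[i]; rewrite negbK => badi.
  apply/existsP; exists i; rewrite /lost badi (goodW _ _ _ (subsetDl _ _) gS) !andbT.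
  apply: contraTT badi => ui; rewrite setIUl (_ : [set u] :&: nb i = set0) ?set0U.
    exact: (forallP gS).
  by apply/setP=> v; rewrite !inE; case: eqP => // ->; rewrite (negPf ui).
suff lost_sum : \sum_(i | u \in nb i) pr R (lost i) <= d * pr R (good S).
  by rewrite mulrBl mul1r lerBlDr; apply: le_trans cover _; rewrite lerD2l.
(* After multiplication by (1 - d)^(DA - 1), each of the at most DB terms is bounded by [lost_le],
   and [pd] concludes. *)
rewrite -(ler_pM2l c_gt0) mulr_sumr.
apply: le_trans (ler_sum _ lost_le) _.
rewrite sumr_const; move: (pr R (good S)) (pr_ge0 R (good S)) => g g_ge0.
apply: (@le_trans _ _ (DB%:R * p * g)).
  rewrite -[leLHS]mulr_natl -mulrA ler_wpM2r ?mulr_ge0 // ler_nat.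
  by have := card_nbC u; rewrite cardsE.
by rewrite mulrCA mulrA ler_wpM2r.
Qed.

(** The chain from the empty set to the whole of V gives the good functions probability at least (1
    - d)^|V| > 0. *)
Lemma local_lemma : exists f, forall i, ~~ bad i (nb i) f.
Proof.
have chain := @pr_good_chain #|V|.+1 (fun S u _ => @pr_good_step S u).
have := chain setT set0; rewrite cardsT leqnSn sub0set => /(_ isT isT).
rewrite (pr_true R K_gt0 (P := good set0)); last first.
  by move=> f; apply/forallP=> i; rewrite set0I bad0.
rewrite mulr1 => /(lt_le_trans _) lt.
have [|f /forallP goodf] := @pr_gt0_ex R V K (good setT).
  by apply: lt; rewrite exprn_gt0 // subr_gt0.
by exists f => i; have := goodf i; rewrite setTI.
Qed.

End LocalLemma.

(** * The probability that a whole list is hit *)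

(* AM-GM twice: the factors 1 - q^d have at most the geometric mean they would
   have at the average exponent, which is at most m. *)
Lemma prod_sub_exp_le (R : realFieldType) (C : Type) (X : seq C)
    (d : C -> nat) (m : nat) (q : R) :
    0 <= q <= 1 -> (\sum_(x <- X) d x <= m * size X)%N ->
  \prod_(x <- X) (1 - q ^+ d x) <= (1 - q ^+ m) ^+ size X.
Proof.
move=> /andP[q0 q1] sumd.
case: X sumd => [|x0 X] sumd; first by rewrite big_nil expr0.
move: sumd; set Y := x0 :: X; set n := size Y => sumd.
have n0 : 0 < n%:R :> R by rewrite ltr0n.
rewrite !(big_nth x0) !big_mkord -/n in sumd *.
pose e (i : 'I_n) := d (nth x0 Y i); rewrite -/e in sumd *.
have qe i : 0 <= q ^+ e i <= 1 by rewrite exprn_ge0 ?exprn_ile1.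
have AG1 := leif_AGM (A := 'I_n) (E := fun i => 1 - q ^+ e i).
have AG2 := leif_AGM (A := 'I_n) (E := fun i => q ^+ e i).
rewrite /= card_ord in AG1 AG2.
have {}AG1 :
    \prod_(i < n) (1 - q ^+ e i) <= ((\sum_(i < n) (1 - q ^+ e i)) / n%:R) ^+ n.
  by apply: AG1 => i _; rewrite subr_ge0; case/andP: (qe i).
have {}AG2 : \prod_(i < n) q ^+ e i <= ((\sum_(i < n) q ^+ e i) / n%:R) ^+ n.
  by apply: AG2 => i _; case/andP: (qe i).
apply: le_trans AG1 _.
have Dmu : (\sum_(i < n) (1 - q ^+ e i)) / n%:R = 1 - (\sum_(i < n) q ^+ e i) / n%:R.
  by rewrite sumrB sumr_const card_ord mulrBl divff // gt_eqF.
have mu0 : 0 <= (\sum_(i < n) (1 - q ^+ e i)) / n%:R.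
  rewrite divr_ge0 ?ler0n // sumr_ge0 // => i _; by rewrite subr_ge0; case/andP: (qe i).
apply: lerXn2r; rewrite ?nnegrE //; first by rewrite subr_ge0 exprn_ile1.
(* It remains to bound the mean of the [q ^+ e i] below by [q ^+ m]. In n-th powers this follows
   from AM-GM, since the product of the [q ^+ e i] has total exponent at most m n. *)
rewrite Dmu lerD2l lerN2 -(@ler_pXn2r _ n) ?nnegrE ?exprn_ge0 //; last first.
  by rewrite divr_ge0 ?ler0n // sumr_ge0 // => i _; case/andP: (qe i).
apply: le_trans AG2; rewrite -exprM prodrXr; apply: ler_wiXn2l => //.
Qed.

Section Hitting.
Variables (R : realFieldType) (V K : finType) (C : eqType).
Variables (col : V -> K -> C).
Hypothesis K_gt0 : (0 < #|K|)%N.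

(** A function f selects a position in each list, and [col u j] is the colour at position j in the
    list of u; thus all vertices share the index type K. *)
Definition hit (T : {set V}) (f : {ffun V -> K}) (x : C) :=
  [exists u in T, col u (f u) == x].

(** As [codom (col u)] is the list of u, these are the exponents d_x. *)
Definition ncol (T : {set V}) (x : C) := #|[set u in T | x \in codom (col u)]|.

Lemma hit_dep T (X : seq C) : depends_on T (fun f => all (hit T f) X).
Proof.
move=> f g eq_fg; apply: eq_all => x; apply: eq_existsb => u.
by case uT: (u \in T); rewrite //= eq_fg.
Qed.

Lemma hit_mono (S T : {set V}) f x : S \subset T -> hit S f x -> hit T f x.
Proof.
by move/subsetP=> sST /exists_inP[u uS fu]; apply/exists_inP; exists u; rewrite ?sST.
Qed.

(** Each j raises at most one factor to 1, so for uniform j the factors are negatively correlated: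
    the mean of the product is at most the product of the means. *)
Lemma sum_prod_skip_le (c : K -> C) (a : C -> R) (X : seq C) :
    injective c -> uniq X -> (forall x, 0 <= a x <= 1) ->
  \sum_j \prod_(x <- X | x != c j) a x <=
  #|K|%:R * \prod_(x <- X) (a x + (x \in codom c)%:R * (1 - a x) / #|K|%:R).
Proof.
move=> c_inj uX a01; have K0 : 0 < #|K|%:R :> R by rewrite ltr0n.
have a0 x : 0 <= a x by case/andP: (a01 x).
have a1 x : 0 <= 1 - a x by case/andP: (a01 x); rewrite subr_ge0.
elim: X uX => [|x X IHX] /=.
  by rewrite big_nil mulr1 => _; under eq_bigr do rewrite big_nil; rewrite sumr_const.
case/andP=> xX /IHX {}IHX; rewrite big_cons; set Pi := (X in _ * (_ * X)).
rewrite -/Pi in IHX.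
have prod_le : \prod_(y <- X) a y <= Pi.
  apply: ler_prod => y _; rewrite a0 lerDl divr_ge0 ?mulr_ge0 ?ler0n //.
case: (boolP (x \in codom c)) => [/codomP[j0 xj0]|xc].
  rewrite mul1r (bigD1 j0) //= big_cons -xj0 eqxx /=.
  rewrite (eq_bigr (fun j => a x * \prod_(y <- X | y != c j) a y)); last first.
    move=> j jj0; rewrite big_cons xj0 ifT //.
    by apply: contra jj0 => /eqP/c_inj->.
  have prodX : \prod_(y <- X | y != x) a y = \prod_(y <- X) a y.
    rewrite big_seq_cond [RHS]big_seq_cond; apply: eq_bigl => y.
    by rewrite andbT andb_idr // => yX; apply: contraNneq xX => <-.
  move: IHX; rewrite (bigD1 j0) //= -xj0 prodX.
  rewrite -mulr_sumr; move: (\sum_(_ | _) _) (\prod_(_ <- _) _) prod_le => s t tPi IH.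
  (* With t the term of j0 before x is added and s the sum of the others, the new sum is t + a s = a
     (t + s) + (1 - a) t; the induction hypothesis bounds t + s and [prod_le] bounds t. *)
  have -> : #|K|%:R * ((a x + (1 - a x) / #|K|%:R) * Pi)
          = a x * (#|K|%:R * Pi) + (1 - a x) * Pi.
    by field; rewrite gt_eqF.
  have := ler_wpM2l (a0 x) IH; have := ler_wpM2l (a1 x) tPi; lra.
rewrite mul0r mul0r addr0 mulrCA.
rewrite (eq_bigr (fun j => a x * \prod_(y <- X | y != c j) a y)); last first.
  move=> j _; rewrite big_cons ifT //.
  by apply: contraNneq xc => ->; rewrite codom_f.
by rewrite -mulr_sumr ler_wpM2l.
Qed.

Let q : R := 1 - #|K|%:R^-1.

Let q01 : 0 <= q <= 1.
Proof. exact: sub_inv_itv. Qed.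

(** Given the colour of one vertex u of T, the other vertices must hit the remaining colours of X.
    Induction bounds this for each colour, and [sum_prod_skip_le] averages over the colours of u. *)
Lemma pr_all_hit_le (T : {set V}) (X : seq C) :
    {in T, forall u, injective (col u)} -> uniq X ->
  pr R (fun f => all (hit T f) X) <= \prod_(x <- X) (1 - q ^+ ncol T x).
Proof.
move Dn: #|T| => n; elim: n => [|n IHn] in T X Dn * => col_inj uX.
  have T0 : T = set0 by apply/eqP; rewrite -cards_eq0 Dn.
  case: X uX => [|x X] _; first by rewrite big_nil pr_true.
  rewrite pr_false; last first.
    by move=> f; rewrite /= (_ : hit T f x = false) //;
      apply/exists_inP=> -[u]; rewrite T0 inE.
  apply: prodr_ge0 => y _; rewrite subr_ge0 exprn_ile1 //; by case/andP: q01.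
have [u uT] : exists u, u \in T by apply/card_gt0P; rewrite Dn.
pose T' := T :\ u; have DT : T = u |: T' by rewrite setD1K.
have Dn' : #|T'| = n by apply: succn_inj; rewrite -Dn (cardsD1 u T) uT.
have sT'T : {subset T' <= T} by move=> v /setD1P[].
pose X' j := [seq x <- X | x != col u j].
have K0 : 0 < #|K|%:R :> R by rewrite ltr0n.
have cover : pr R (fun f => all (hit T f) X)
    <= \sum_j pr R (fun f => (f u == j) && all (hit T' f) (X' j)).
  apply: pr_cover => f /allP allX; exists (f u); rewrite eqxx /=.
  apply/allP=> x; rewrite mem_filter => /andP[xu /allX/exists_inP[v vT fv]].
  apply/exists_inP; exists v => //; rewrite !inE vT andbT.
  by apply: contraNneq xu => <-; rewrite eq_sym.
apply: le_trans cover _.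
have step j : pr R (fun f => (f u == j) && all (hit T' f) (X' j))
    <= #|K|%:R^-1 * \prod_(x <- X | x != col u j) (1 - q ^+ ncol T' x).
  rewrite (pr_indep _ K_gt0 (T := [set u])); first last.
  - move=> f g eq_fg; apply: hit_dep => v vT'; apply: eq_fg.
    by move: vT'; rewrite !inE => /andP[].
  - by move=> f g eq_fg; rewrite eq_fg ?inE.
  rewrite pr_coord // ler_wpM2l ?invr_ge0 ?ler0n // -big_filter.
  by apply: IHn => //; [move=> v /sT'T; apply: col_inj | rewrite filter_uniq].
apply: le_trans (ler_sum _ (fun j _ => step j)) _.
rewrite -mulr_sumr ler_pdivrMl //.
have a01 x : 0 <= 1 - q ^+ ncol T' x <= 1.
  have /andP[q0 q1] := q01.
  by rewrite subr_ge0 exprn_ile1 //= lerBlDr lerDl exprn_ge0.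
apply: le_trans (sum_prod_skip_le (col_inj u uT) uX a01) _.
rewrite ler_pM2l // le_eqVlt; apply/orP; left; apply/eqP/eq_bigr => x _.
have -> : ncol T x = ((x \in codom (col u)) + ncol T' x)%N.
  rewrite /ncol (cardsD1 u) !inE uT /=; congr (_ + _)%N.
  by apply: eq_card => v; rewrite !inE andbA.
case: (x \in codom _) => /=; last by rewrite mul0r mul0r addr0 add0n.
(* This is 1 - q^n + q^n/#|K| = 1 - q^(n + 1). *)
by rewrite exprS /q; field; rewrite gt_eqF.
Qed.

(** Double counting: each u in T contributes at most #|K| colours of X. *)
Lemma sum_ncol_le (T : {set V}) (X : seq C) : uniq X ->
  (\sum_(x <- X) ncol T x <= #|T| * #|K|)%N.
Proof.
move=> uX; rewrite -sum_nat_const.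
under eq_bigr => x _ do rewrite /ncol -sum1dep_card big_mkcondr /=.
rewrite exchange_big /=; apply: leq_sum => u _.
rewrite -big_mkcond sum1_count -size_filter -(size_codom (col u)).
apply: uniq_leq_size; first exact: filter_uniq.
by move=> x; rewrite mem_filter => /andP[].
Qed.

End Hitting.

(** * From the local lemma to list colouring *)

(** In the product bound, n stands for the numbers d_x, known only through their sum and their
    maximum. The balanced case relies on the sum, the unbalanced one on the maximum. *)
Lemma choosable_criterion (R : realFieldType) (V : finType) (e : rel V)
    (A B : {set V}) (DA DB kA kB : nat) (p d : R) :
    symmetric e -> bipartite_with_parts e A B ->
    (forall v, v \in A -> (degree e v <= DA)%N) ->
    (forall v, v \in B -> (degree e v <= DB)%N) ->
    (0 < kA)%N -> (0 < kB)%N -> 0 <= d < 1 ->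
    (forall (X : seq nat) (n : nat -> nat), size X = kA ->
       (\sum_(x <- X) n x <= DA * kB)%N -> (forall x, n x <= DA)%N ->
       \prod_(x <- X) (1 - (1 - kB%:R^-1) ^+ n x) <= p) ->
    0 <= p -> DB%:R * p <= d * (1 - d) ^+ DA.-1 ->
  choosable e A B kA kB.
Proof.
move=> e_sym [ABT dAB eAB] degA degB kA0 kB0 /andP[d0 d1] hp p0 pd L [_ LA LB].
have notAB v : (v \in A) = (v \notin B).
  have : v \in A :|: B by rewrite ABT inE.
  rewrite inE; case vB: (v \in B); last by rewrite orbF => ->.
  by move=> _; apply: (disjointFl dAB vB).
have nbAB u v : u \in A -> e u v -> v \in B.
  by move=> uA /eAB[[]//|[uB _]]; move: uA; rewrite notAB uB.
pose lst v : seq nat := enum_fset (L v).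
have u_lst v : uniq (lst v) by exact: fset_uniq.
pose K : finType := 'I_kB.
have cardK : #|K| = kB by rewrite card_ord.
(* The positions in ['I_kB] fall inside the list of any u in B, where the default 0 is therefore
   never returned. *)
pose col (u : V) (j : K) : nat := nth 0%N (lst u) j.
have col_mem u j : u \in B -> col u j \in L u.
  by move=> uB; apply: mem_nth; rewrite [size _](LB u uB).
have col_inj u : u \in B -> injective (col u).
  move=> uB i j /eqP; rewrite /col nth_uniq ?[size _](LB u uB) //.
  by move/eqP/val_inj.
(* Events are indexed by all of V; those outside A get no coordinates and never occur. *)
pose nb v : {set V} := if v \in A then [set w | e v w] else set0.
have nbB v u : u \in nb v -> [/\ v \in A, u \in B & e v u].
  rewrite /nb; case: ifP => [vA|]; last by rewrite inE.
  by rewrite inE => evu; split=> //; apply: nbAB evu.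
pose bad v T (f : {ffun V -> K}) := (v \in A) && all (hit col T f) (lst v).
have K0 : (0 < #|K|)%N by rewrite cardK.
have card_nb v : (#|nb v| <= DA)%N.
  by rewrite /nb; case: ifP => [/degA|_]; rewrite ?cards0.
have [] := @local_lemma R V K V nb bad DA DB p d K0 => //.
- by move=> v T f g eq_fg; congr (_ && _); apply: hit_dep eq_fg.
- move=> v S T f sST /andP[vA /allP all_hit]; rewrite /bad vA /=.
  by apply/allP=> x /all_hit; apply: hit_mono.
- move=> v f; rewrite /bad; case vA: (v \in A) => //=.
  have : (0 < size (lst v))%N by rewrite [size _](LA v vA).
  case: (lst v) => //= x s _; rewrite negb_and; apply/orP; left.
  by apply/exists_inP=> -[u]; rewrite inE.
- move=> v T sT; case vA: (v \in A); last first.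
    by rewrite pr_false // => f; rewrite /bad vA.
  have TB : {in T, forall u, injective (col u)}.
    by move=> u /(subsetP sT)/nbB[_ uB _]; apply: col_inj.
  have cardT : (#|T| <= DA)%N by apply: leq_trans (card_nb v); apply: subset_leq_card.
  rewrite (@eq_pr R _ _ _ (fun f => all (hit col T f) (lst v))); last first.
    by move=> f; rewrite /bad vA.
  apply: le_trans (pr_all_hit_le R K0 TB (u_lst v)) _; rewrite cardK.
  apply: hp; first exact: LA.
    apply: leq_trans (sum_ncol_le col T (u_lst v)) _.
    by rewrite cardK leq_mul2r cardT orbT.
  move=> x; apply: leq_trans cardT; apply: subset_leq_card.
  by apply/subsetP=> u; rewrite inE => /andP[].
- move=> u; have [uB|uB] := boolP (u \in B).
    apply: leq_trans (degB u uB); apply: subset_leq_card.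
    by apply/subsetP=> v; rewrite !inE => /nbB[_ _]; rewrite e_sym.
  rewrite (_ : [set i | _] = set0) ?cards0 //.
  by apply/setP=> v; rewrite !inE; apply: contraNF uB => /nbB[].
move=> f goodf.
pose free v := [seq x <- lst v | ~~ hit col (nb v) f x].
(* For v in A some colour is free, since v is not bad; the default of [head] is not reached. *)
pose c v := if v \in B then col v (f v) else head 0%N (free v).
have cA v : v \in A -> c v \in free v.
  move=> vA; have := goodf v; rewrite /bad vA /= -has_predC => has_free.
  rewrite /c (_ : v \in B = false); last by apply: contraTF vA; rewrite notAB negbK.
  by move: has_free; rewrite has_filter -/(free v);
    case: (free v) => // *; apply: mem_head.
have cAB u v : u \in A -> e u v -> c u <> c v.
  move=> uA euv eq_c; have := cA u uA; rewrite mem_filter => /andP[/exists_inP[]].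
  have vB := nbAB u v uA euv.
  by exists v; [rewrite /nb uA inE | rewrite eq_c /c vB].
exists c => [u v euv|v]; last first.
  have [vB|vB] := boolP (v \in B); first by rewrite /c vB col_mem.
  by have := cA v; rewrite notAB vB mem_filter => /(_ isT)/andP[].
have [[uA _]|[_ vA]] := eAB u v euv; first exact: cAB.
by apply/nesym/cAB => //; rewrite e_sym.
Qed.

(** * Choice of p and d in the two cases *)

Section Cases.
Variables (V : finType) (e : rel V) (A B : {set V}) (DA DB : nat).
Hypotheses (e_sym : symmetric e) (hAB : bipartite_with_parts e A B)
  (degA : forall v, v \in A -> (degree e v <= DA)%N)
  (degB : forall v, v \in B -> (degree e v <= DB)%N).

Lemma choosable_balanced : (165 <= DA)%N -> (56 <= DB <= DA)%N ->
  choosable e A B (uphalf DA + 1) (uphalf DB + 1).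
Proof.
(* R stays abstract: over rat itself, conversion would compute fractions. *)
have [R _] : exists R : realFieldType, True by exists rat.
move=> DA165 /andP[DB56 DBA].
set kA := (uphalf DA + 1)%N; set kB := (uphalf DB + 1)%N.
have kA84 : (84 <= kA)%N by lia.
have kB29 : (29 <= kB)%N by lia.
have DA2 : (DA <= 2 * kA.-1)%N by lia.
pose D : R := DA%:R; have D1 : 1 <= D by rewrite ler1n; lia.
(* The base 0.87 is 1 - 0.13, from [sub_inv_exp2_ge]. By Bernoulli this d keeps (1 - d)^(DA - 1) at
   least 1/2, so D p <= 1/(4 D) suffices. *)
pose p : R := (87 / 100) ^+ kA; pose d : R := (2 * D)^-1.
have d01 : 0 < d <= 1 / 2.
  by rewrite invr_gt0 -[1 / 2]invrK lef_pV2 ?posrE //; lra.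
have p_ge0 : 0 <= p by rewrite exprn_ge0 //; lra.
have half_le : 1 / 2 <= (1 - d) ^+ DA.-1.
  have : 1 + DA.-1%:R * - d <= (1 + - d) ^+ DA.-1 by apply: bernoulli_ineq; lra.
  apply: le_trans; have Dpred : DA.-1%:R <= D by rewrite ler_nat leq_pred.
  have Dd : D * d = 1 / 2 by rewrite /d; field; lra.
  have : DA.-1%:R * d <= D * d by rewrite ler_wpM2r //; lra.
  by lra.
apply: (@choosable_criterion R V e A B DA DB kA kB p d) => //; try lia.
- lra.
- move=> X n sizeX sum_le _.
  have /andP[q0 q1] := @sub_inv_itv R kB ltac:(lia).
  (* As DA is at most 2 kA, the exponents average at most 2 kB. *)
  apply: le_trans (prod_sub_exp_le (m := (2 * kB)%N) _ _) _; first by rewrite q0.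
    by rewrite sizeX; apply: leq_trans sum_le _; nia.
  rewrite sizeX; have := sub_inv_exp2_ge R kB29 => q13.
  by apply: lerXn2r; rewrite ?nnegrE ?subr_ge0 ?exprn_ile1 //; lra.
- have := sq_mul_exp_le1 R (k := kA.-1); rewrite prednK; last by lia.
  move=> /(_ ltac:(lia)); rewrite -/p => le1.
  have DB_le : DB%:R <= D by rewrite ler_nat.
  have D_le : D <= 2 * kA.-1%:R by rewrite -(natrM _ 2) ler_nat.
  have : 4 * D ^+ 2 * p <= 1.
    apply: le_trans le1; rewrite ler_wpM2r //; nra.
  move=> {}le1; apply: (@le_trans _ _ (D * p)); first by rewrite ler_wpM2r.
  apply: (@le_trans _ _ (d * (1 / 2))); last by rewrite ler_wpM2l //; lra.
  rewrite -(ler_pM2l (_ : 0 < 4 * D)); last by lra.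
  rewrite (_ : 4 * D * (d * _) = 1); last by rewrite /d; field; lra.
  by move: le1; rewrite expr2 !mulrA.
Qed.

Lemma choosable_unbalanced : (0 < DA <= 55)%N -> (153 <= DB)%N ->
  choosable e A B (uphalf DA + 1) (uphalf DB + 1).
Proof.
have [R _] : exists R : realFieldType, True by exists rat.
move=> DA55 DB153; have /andP[DA0 _] := DA55.
rewrite (addn1 (uphalf DA)); set h := uphalf DA; set k := (uphalf DB + 1)%N.
have k78 : (78 <= k)%N by lia.
have DBk : (DB <= 2 * k)%N by lia.
pose D : R := DA%:R; have D1 : 1 <= D by rewrite ler1n.
have k78R : 78 <= k%:R :> R by rewrite (ler_nat _ 78).
(* This d is close to 1/DA, which maximises d (1 - d)^(DA - 1), but stays below 1 even when DA =
   1. *)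
pose p : R := (D / k%:R) ^+ h.+1; pose d : R := (D + 1)^-1.
have p_ge0 : 0 <= p by rewrite exprn_ge0 // divr_ge0 // ler0n.
have d01 : 0 < d < 1 by rewrite invr_gt0 invf_lt1; lra.
apply: (@choosable_criterion R V e A B DA DB h.+1 k p d) => //; try lia.
- lra.
- move=> X n sizeX _ n_le.
  have q01 := @sub_inv_itv R k ltac:(lia).
  have -> : p = \prod_(x <- X) (D / k%:R).
    by rewrite big_const_seq count_predT sizeX iter_mulr_1.
  apply: ler_prod => x _.
  rewrite subr_ge0 exprn_ile1 ?andTb; try by case/andP: q01.
  (* Bernoulli gives 1 - (1 - 1/k)^n <= n/k, and n is at most DA. *)
  have : 1 + (n x)%:R * - k%:R^-1 <= (1 + - k%:R^-1) ^+ n x :> R.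
    by apply: bernoulli_ineq; case/andP: q01; lra.
  have : (n x)%:R / k%:R <= D / k%:R by rewrite ler_wpM2r ?invr_ge0 ?ler0n // ler_nat.
  by lra.
- have := unbalanced_exp_bound DA55; rewrite -/h -(ler_nat R) !natrM !natrX.
  rewrite -natr1 -/D => chk.
  (* Since DB is at most 2 k, the left side is at most 2 k p = 2 D (D/k)^h, which does not increase
     with k; so k = 78 is the worst case. *)
  apply: (@le_trans _ _ (2 * 78 * (D / 78) ^+ h.+1)).
    apply: (@le_trans _ _ (2 * k%:R * p)).
      by rewrite ler_wpM2r // -natrM ler_nat.
    rewrite /p !exprS !mulrA.
    have -> : 2 * k%:R * D / k%:R = 2 * D by field; lra.
    have -> : 2 * 78 * D / 78 = 2 * D by field.
    rewrite ler_wpM2l; [|lra|]; last first.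
      apply: lerXn2r; rewrite ?nnegrE ?divr_ge0 ?ler0n //; try lra.
      by rewrite ler_wpM2l ?lef_pV2 ?posrE //; lra.
    by [].
  have -> : d * (1 - d) ^+ DA.-1 = D ^+ DA.-1 / (D + 1) ^+ DA.
    have -> : 1 - d = D * d by rewrite /d; field; lra.
    by rewrite exprMn mulrCA -exprS prednK // exprVn.
  rewrite expr_div_n mulrA ler_pdivrMr ?exprn_gt0 //.
  rewrite [leRHS]mulrAC ler_pdivlMr; last first.
    by rewrite exprn_gt0 //; lra.
  by rewrite [leLHS]mulrC mulrA.
Qed.

End Cases.

Local Close Scope ring_scope.

(** * Exchange of the two parts, and the theorem *)

Lemma bipartite_with_partsC (V : finType) (e : rel V) (A B : {set V}) :
  bipartite_with_parts e A B -> bipartite_with_parts e B A.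
Proof.
case=> ABT dAB eAB; split; [by rewrite setUC | by rewrite disjoint_sym |].
by move=> u v /eAB[]; [right | left].
Qed.

Lemma choosableC (V : finType) (e : rel V) (A B : {set V}) (kA kB : nat) :
  choosable e B A kB kA -> choosable e A B kA kB.
Proof. by move=> chBA L [L0 LA LB]; apply: chBA. Qed.

(* [uphalf n] is the ceiling of n / 2. *)
Theorem theorem3p4 (DA DB : nat) (hDA : 0 < DA) (hDB : 0 < DB)
  (hD : [\/ 165 <= DA /\ 56 <= DB <= DA,
            DA <= 55 /\ 153 <= DB,
            165 <= DB /\ 56 <= DA <= DB
          | DB <= 55 /\ 153 <= DA])
  (V : finType) (e : rel V) (A B : {set V})
  (hG : simple_graph e)
  (hAB : bipartite_with_parts e A B)
  (degA : forall v : V, v \in A -> degree e v <= DA)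
  (degB : forall v : V, v \in B -> degree e v <= DB) :
  choosable e A B (uphalf DA + 1) (uphalf DB + 1).
Proof.
have [e_sym _] := hG; have hBA := bipartite_with_partsC hAB.
case: hD => [[hA hB]|[hA hB]|[hB hA]|[hB hA]].
- exact: choosable_balanced.
- by apply: choosable_unbalanced => //; rewrite hDA.
- exact/choosableC/choosable_balanced.
- by apply/choosableC/choosable_unbalanced => //; rewrite hDB.
Qed.
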